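(* Let $G$ be a commutative multiplicative hyperring with identity $1$, let $A$ be a $\mathcal{C}$-hyperideal of $G$ and let $S$ be a multiplicative closed subset of $G$ such that $A\cap S=\varnothing$ and $t\circ\mathrm{rad}(A)^2\subseteq A$ for some $t\in S$. Then $A$ is a strongly quasi $S$-primary hyperideal of $G$ if and only if $A$ is a quasi $S$-primary hyperideal of $G$.
   Context: A commutative multiplicative hyperring with identity is a triple $(G,+,\circ)$ where $(G,+)$ is an abelian group and $\circ$ assigns to each pair $(x,y)\in G\times G$ a non-empty subset $x\circ y\subseteq G$, such that for all $x,y,z\in G$: $(x\circ y)\circ z=x\circ(y\circ z)$; $(-x)\circ y=x\circ(-y)=-(x\circ y)$; $(y+z)\circ x\subseteq y\circ x+z\circ x$ and $x\circ(y+z)\subseteq x\circ y+x\circ z$; $x\circ y=y\circ x$; and there is $1\in G$ with $a\in 1\circ a$ for all $a\in G$. For non-empty subsets $X,Y\subseteq G$, $X\circ Y=\bigcup_{x\in X,y\in Y}x\circ y$, $X^2=X\circ X$ and $X+Y=\{x+y: x\in X,y\in Y\}$; elements are identified with singletons, so $u^2=u\circ u$. A hyperideal of $G$ is a non-empty $A\subseteq G$ with $x-y\in A$ for all $x,y\in A$ and $r\circ x\subseteq A$ for all $x\in A$, $r\in G$. A proper hyperideal $P$ is prime if $x\circ y\subseteq P$ ($x,y\in G$) implies $x\in P$ or $y\in P$. $\mathrm{rad}(A)$ is the intersection of all prime hyperideals containing $A$, and $\mathrm{rad}(A)=G$ if there are none. $A$ is a $\mathcal{C}$-hyperideal if for all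 $n\in\mathbb{N}$ and $a_1,\dots,a_n\in G$, $(a_1\circ\cdots\circ a_n)\cap A\neq\varnothing$ implies $a_1\circ\cdots\circ a_n\subseteq A$. A multiplicative closed subset (MCS) of $G$ is a subset $S\subseteq G$ containing $1$ with $(s_1\circ s_2)\cap S\neq\varnothing$ for all $s_1,s_2\in S$. Let $A$ be a hyperideal with $A\cap S=\varnothing$. $A$ is quasi $S$-primary if there is $t\in S$ such that for all $u,v\in G$, $u\circ v\subseteq A$ implies $t\circ u\subseteq \mathrm{rad}(A)$ or $t\circ v\subseteq\mathrm{rad}(A)$. $A$ is strongly quasi $S$-primary if there is $t\in S$ such that for all $u,v\in G$, $u\circ v\subseteq A$ implies $t\circ u^2\subseteq A$ or $t\circ v\subseteq\mathrm{rad}(A)$. *)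

(* Defs.v *)
From mathcomp Require Import all_boot all_algebra.
From mathcomp Require Import boolp classical_sets.

Set Implicit Arguments.
Unset Strict Implicit.
Unset Printing Implicit Defensive.

Import GRing.Theory.

Local Open Scope classical_set_scope.
Local Open Scope ring_scope.

Definition setmul (G : Type) (op : G -> G -> set G) (X Y : set G) : set G :=
  \bigcup_(x in X) \bigcup_(y in Y) op x y.

Record comHyperring := ComHyperring {
  carrier :> zmodType;
  hmul : carrier -> carrier -> set carrier;
  hone : carrier;
  hmul_nonempty : forall x y, hmul x y !=set0;
  hmulA : forall x y z,
    setmul hmul (hmul x y) [set z] = setmul hmul [set x] (hmul y z);
  hmulNl : forall x y, hmul (- x) y = [set - w | w in hmul x y];
  hmulNr : forall x y, hmul x (- y) = [set - w | w in hmul x y];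
  hmulDl : forall x y z,
    hmul (y + z) x `<=` [set a + b | a in hmul y x & b in hmul z x];
  hmulDr : forall x y z,
    hmul x (y + z) `<=` [set a + b | a in hmul x y & b in hmul x z];
  hmulC : forall x y, hmul x y = hmul y x;
  hmul1 : forall a, hmul hone a a
}.

Arguments hmul {c} x y.
Arguments hone {c}.

Declare Scope hyperring_scope.
Notation "x `o y" := (hmul x y)
  (at level 40, left associativity) : hyperring_scope.
Notation "X `o` Y" := (setmul hmul X Y)
  (at level 40, left associativity) : hyperring_scope.
Local Open Scope hyperring_scope.

Section Hyperideals.
Variable G : comHyperring.
Implicit Types (A P S : set G).

Definition hyperideal A : Prop :=
  [/\ A !=set0,
      forall x y, A x -> A y -> A (x - y) &
      forall r x, A x -> r `o x `<=` A].

Definition prime_hyperideal P : Prop :=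
  [/\ hyperideal P, P <> setT &
      forall x y, x `o y `<=` P -> P x \/ P y].

(* The empty intersection is [setT], as required when no prime hyperideal
   contains [A]. *)
Definition hrad A : set G :=
  \bigcap_(P in [set P | prime_hyperideal P /\ A `<=` P]) P.

(* The product of the non-empty sequence [a :: s]; for [s = [::]] it is the
   singleton of [a]. *)
Definition hprod (a : G) (s : seq G) : set G :=
  foldl (fun X b => X `o` [set b]) [set a] s.

Definition C_hyperideal A : Prop :=
  hyperideal A /\
  forall (a : G) (s : seq G), hprod a s `&` A !=set0 -> hprod a s `<=` A.

Definition mult_closed S : Prop :=
  S hone /\ forall s1 s2, S s1 -> S s2 -> (s1 `o s2) `&` S !=set0.

Definition quasi_S_primary S A : Prop :=
  [/\ hyperideal A, A `&` S = set0 &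
      exists2 t, S t & forall u v, u `o v `<=` A ->
        t `o u `<=` hrad A \/ t `o v `<=` hrad A].

Definition strongly_quasi_S_primary S A : Prop :=
  [/\ hyperideal A, A `&` S = set0 &
      exists2 t, S t & forall u v, u `o v `<=` A ->
        [set t] `o` (u `o u) `<=` A \/ t `o v `<=` hrad A].

End Hyperideals.

(* Main.v *)
Require Import Defs.
From mathcomp Require Import all_boot all_algebra.
From mathcomp Require Import boolp classical_sets.

(** Write [t . X] for the product with a singleton.

    Strongly quasi implies quasi with the same [t]: if [t . (u . u)] lies in
    [A], it lies in every prime [P] containing [A], so [P] contains [t] or [u]
    and hence [t . u] ([mul_sub_hrad]).

    Conversely, let [s] witness that [A] is quasi [S]-primary, and let [t] be
    such that [t . rad(A)^2] lies in [A].  If [s . u] lies in [rad(A)], then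
    [t . (s . u) . (s . u)] lies in [A]; by associativity and commutativity
    this set is [(t . s . s) . (u . u)].  As [S] is multiplicatively closed,
    [t . s . s] meets [S], and any element [r] of the intersection satisfies
    that [r . (u . u)] lies in [A].  The same [r] serves the other alternative,
    since [rad(A)] absorbs products: if [s . v] lies in [rad(A)], so does
    [r . v]. *)

Local Open Scope classical_set_scope.
Local Open Scope hyperring_scope.

Lemma setmulP (G : comHyperring) (X Y : set G) (z : G) :
  (X `o` Y) z <-> exists x y, [/\ X x, Y y & (x `o y) z].
Proof.
split=> [[x Xx [y Yy xyz]]|[x [y [Xx Yy xyz]]]]; first by exists x, y.
by exists x => //; exists y.
Qed.

Lemma setmul11 (G : comHyperring) (x y : G) : [set x] `o` [set y] = x `o y.
Proof. by rewrite /setmul !bigcup_set1. Qed.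

Lemma setmulS (G : comHyperring) (X X' Y Y' : set G) :
  X `<=` X' -> Y `<=` Y' -> X `o` Y `<=` X' `o` Y'.
Proof.
move=> sX sY z /setmulP[x [y [Xx Yy xyz]]]; apply/setmulP.
by exists x, y; split=> //; [exact: sX | exact: sY].
Qed.

Lemma setmulC (G : comHyperring) (X Y : set G) : X `o` Y = Y `o` X.
Proof.
suff sub (Z T : set G) : Z `o` T `<=` T `o` Z by apply/seteqP; split; exact: sub.
move=> z /setmulP[x [y [Zx Ty xyz]]]; apply/setmulP.
by exists y, x; rewrite hmulC.
Qed.

Lemma setmulA (G : comHyperring) (X Y Z : set G) :
  X `o` Y `o` Z = X `o` (Y `o` Z).
Proof.
suff sub (U V W : set G) : U `o` V `o` W `<=` U `o` (V `o` W).
  apply/seteqP; split; first exact: sub.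
  (* Reversing the three factors exchanges the two bracketings. *)
  rewrite [X `o` _]setmulC [Y `o` Z]setmulC [(X `o` Y) `o` Z]setmulC.
  by rewrite [X `o` Y]setmulC; exact: sub.
move=> w /setmulP[p [z [/setmulP[x [y [Ux Vy xyp]]] Wz pzw]]].
have : (setmul hmul (x `o y) [set z]) w by apply/setmulP; exists p, z.
rewrite hmulA -setmul11; apply: setmulS; first by move=> ? ->.
by apply: setmulS => ? ->.
Qed.

Lemma setmulCA (G : comHyperring) (X Y Z : set G) :
  X `o` (Y `o` Z) = Y `o` (X `o` Z).
Proof. by rewrite -!setmulA [X `o` Y]setmulC. Qed.

Lemma setmulACA (G : comHyperring) (X Y Z T : set G) :
  (X `o` Y) `o` (Z `o` T) = (X `o` Z) `o` (Y `o` T).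
Proof. by rewrite !setmulA [Y `o` (Z `o` T)]setmulCA. Qed.

Lemma hrad_absorb (G : comHyperring) (A X Y : set G) :
  Y `<=` hrad A -> X `o` Y `<=` hrad A.
Proof.
move=> sYA z /setmulP[x [y [_ Yy xyz]]] P [pP sAP].
by have [[_ _ absP] _ _] := pP; apply: (absP x y) xyz; apply: (sYA y Yy).
Qed.

(** A prime containing [t . w] for each [w] in [u . u], but not [t], contains
    all of [u . u], and therefore [u]. *)
Lemma mul_sub_hrad (G : comHyperring) (A : set G) (t u : G) :
  [set t] `o` (u `o u) `<=` A -> t `o u `<=` hrad A.
Proof.
move=> tuuA z tuz P [[[_ _ absP] _ primeP] sAP].
have [tP|ntP] := pselect (P t).
  by apply: (absP u t tP); rewrite hmulC.
suff uP : P u by exact: (absP t u uP).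
suff uuP : u `o u `<=` P by case: (primeP u u uuP).
move=> w uuw; suff twP : t `o w `<=` P by case: (primeP t w twP).
by move=> y twy; apply/sAP/tuuA/setmulP; exists t, w.
Qed.

Theorem theorem4p4 (G : comHyperring) (A S : set G)
    (hA : C_hyperideal A) (hS : mult_closed S) (hAS : A `&` S = set0)
    (hSrad : exists2 t : G, S t & [set t] `o` (hrad A `o` hrad A) `<=` A) :
  strongly_quasi_S_primary S A <-> quasi_S_primary S A.
Proof.
split=> [[iA _ [t St strong]]|[iA _ [s Ss quasi]]]; split=> //.
  exists t => // u v /strong[tuuA|]; last by right.
  by left; exact: mul_sub_hrad.
have [t St trad] := hSrad; have [_ closS] := hS.
have [p [ssp Sp]] := closS _ _ Ss Ss.
have [r [tpr Sr]] := closS _ _ St Sp.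
have r_tss : [set r] `<=` [set t] `o` ([set s] `o` [set s]).
  by move=> _ ->; apply/setmulP; exists t, p; rewrite setmul11.
exists r => // u v /quasi[suA|svA].
  left; apply: subset_trans trad.
  rewrite -[u `o u]setmul11.
  apply: subset_trans (setmulS _ _ _ _ _ r_tss (@subset_refl _ _)) _.
  rewrite setmulA setmulACA setmul11.
  by apply: setmulS => //; exact: setmulS.
right; rewrite -setmul11.
apply: subset_trans (setmulS _ _ _ _ _ r_tss (@subset_refl _ _)) _.
rewrite !setmulA setmul11.
by do 2!apply: hrad_absorb.
Qed.
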